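(* Let $V$ be a graded $A$-module. Then $V$ is presented in finite degrees if and only if $V$ is centrally stable. Moreover, if $V$ is presented in finite degrees, then for $N\in\mathbb{Z}_+$ and $e=e_{0,N}$ the isomorphism $$Ae\otimes_{eAe} eV\cong V$$ holds if and only if $N\geqslant \operatorname{prd}(V)$.
   Context: $R$ is a commutative ring and $\mathbb{Z}_+$ is the set of non-negative integers. $\mathcal{A}$ is an $R$-linear category (a category enriched over $R$-modules) with $\operatorname{Ob}(\mathcal{A})=\mathbb{Z}_+$ and $\operatorname{Hom}_{\mathcal{A}}(m,n)=0$ whenever $m>n$. Its category algebra is the (non-unital) $R$-algebra $A=\bigoplus_{m,n\in\mathbb{Z}_+}\operatorname{Hom}_{\mathcal{A}}(m,n)$, with product given by composition (and zero when morphisms are not composable). For $n\in\mathbb{Z}_+$, $e_n\in A$ is the identity endomorphism of $n$, so $e_nAe_m=\operatorname{Hom}_{\mathcal{A}}(m,n)$; for $m\leqslant n$, $e_{m,n}:=e_m+e_{m+1}+\cdots+e_n$. A graded $A$-module is an $A$-module $V$ with $V=\bigoplus_{n\in\mathbb{Z}_+}e_nV$. A graded $A$-module $V$ is presented in finite degrees if for some $N\in\mathbb{Z}_+$ there is an exact sequence of $A$-modules $$\bigoplus_{j\in J}Ae_{0,N}\to\bigoplus_{i\in I}Ae_{0,N}\to V\to 0,$$ where the indexing sets $I,J$ may be finite or infinite. The smallest such $N$ is called the presentation degree of $V$ and is denoted $\operatorname{prd}(V)$. A graded $A$-module $V$ is centrally stable if for all $N$ sufficiently large one has $Ae\otimes_{eAe}eV\cong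 V$ (as $A$-modules), where $e=e_{0,N}$. *)

(* Defs.v *)
From HB Require Import structures.
From mathcomp Require Import all_boot all_algebra.
From mathcomp Require Import boolp classical_sets functions cardinality fsbigop.

Set Implicit Arguments.
Unset Strict Implicit.
Unset Printing Implicit Defensive.

Import GRing.Theory.
Local Open Scope classical_set_scope.
Local Open Scope ring_scope.

Section FiniteSupportSums.
Variable I : choiceType.

Lemma fsumTE (V : zmodType) (s : seq I) (F : I -> V) :
  uniq s -> (forall i, i \notin s -> F i = 0) ->
  \sum_(i \in [set: I]) F i = \sum_(i <- s) F i.
Proof.
move=> us Fs; rewrite (fsbigE _ _ us) //; last by move=> i _; exact: Fs.
by apply: eq_bigl => i; rewrite in_setT.
Qed.

Lemma finite_supp (V : zmodType) (F : I -> V) (S : set I) :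
  finite_set S -> (forall i, F i != 0 -> S i) ->
  exists2 s : seq I, uniq s & forall i, i \notin s -> F i = 0.
Proof.
case/finite_seqP=> s -> FS; exists (undup s); first exact: undup_uniq.
move=> i; rewrite mem_undup => /negP is_; apply/eqP/negPn/negP => /FS.
exact: is_.
Qed.

Lemma fsumTP (R : pzRingType) (V : lmodType R) (F G : I -> V) (a : R) :
  finite_set [set i | F i != 0] -> finite_set [set i | G i != 0] ->
  \sum_(i \in [set: I]) (a *: F i + G i) =
  a *: (\sum_(i \in [set: I]) F i) + \sum_(i \in [set: I]) G i.
Proof.
move=> /finite_seqP[s sE] /finite_seqP[t tE].
have st (H : I -> V) : (forall i, i \notin undup (s ++ t) -> H i = 0) ->
    \sum_(i \in [set: I]) H i = \sum_(i <- undup (s ++ t)) H i.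
  by move=> H0; rewrite (fsumTE (undup_uniq _) H0).
have F0 i : i \notin undup (s ++ t) -> F i = 0.
  rewrite mem_undup mem_cat negb_or => /andP[/negP is_ _].
  by apply/eqP/negPn/negP => Fi; apply: is_; rewrite -[is_true _]/([set` s] i) -sE.
have G0 i : i \notin undup (s ++ t) -> G i = 0.
  rewrite mem_undup mem_cat negb_or => /andP[_ /negP it].
  by apply/eqP/negPn/negP => Gi; apply: it; rewrite -[is_true _]/([set` t] i) -tE.
rewrite !st //; last by move=> i ni; rewrite F0 // G0 // scaler0 addr0.
by rewrite big_split /= -scaler_sumr.
Qed.

Lemma raddf_fsumT (U V : zmodType) (f : {additive U -> V}) (F : I -> U) :
  finite_set [set i | F i != 0] ->
  f (\sum_(i \in [set: I]) F i) = \sum_(i \in [set: I]) f (F i).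
Proof.
move=> /finite_supp /(_ (fun i => id))[s us s0].
rewrite (fsumTE us s0) raddf_sum (fsumTE us) // => i /s0 ->.
by rewrite raddf0.
Qed.

End FiniteSupportSums.

Section DirectSum.
Variables (R : pzRingType) (I : Type) (M : I -> lmodType R).

Record dsum := DSum {
  dsum_fun :> forall i, M i;
  dsum_finite : finite_set [set i | dsum_fun i != 0] }.

HB.instance Definition _ := gen_eqMixin dsum.
HB.instance Definition _ := gen_choiceMixin dsum.

Lemma dsumP (x y : dsum) : (forall i, x i = y i) -> x = y.
Proof.
case: x y => [x hx] [y hy] /= xy.
have E : x = y by exact: functional_extensionality_dep.
by subst y; congr DSum; exact: Prop_irrelevance.
Qed.

Lemma dsum0_subproof : finite_set [set i | (0 : M i) != 0].
Proof.
by apply: (sub_finite_set (B := set0)) => // i /=; rewrite eqxx.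
Qed.

Lemma dsumD_subproof (x y : dsum) : finite_set [set i | x i + y i != 0].
Proof.
apply: (sub_finite_set (B := [set i | x i != 0] `|` [set i | y i != 0])).
  move=> i /= xy; have [x0|x0] := eqVneq (x i) 0; last by left.
  by right; rewrite x0 add0r in xy.
by rewrite finite_setU; split; apply: dsum_finite.
Qed.

Lemma dsumN_subproof (x : dsum) : finite_set [set i | - x i != 0].
Proof.
by apply: sub_finite_set (dsum_finite x) => i /=; rewrite oppr_eq0.
Qed.

Lemma dsumZ_subproof a (x : dsum) : finite_set [set i | a *: x i != 0].
Proof.
apply: sub_finite_set (dsum_finite x) => i /=; apply: contra_neq => ->.
by rewrite scaler0.
Qed.

Definition dsum0 := DSum dsum0_subproof.
Definition dsumD x y := DSum (dsumD_subproof x y).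
Definition dsumN x := DSum (dsumN_subproof x).
Definition dsumZ a x := DSum (dsumZ_subproof a x).

Lemma dsumDA : associative dsumD.
Proof. by move=> x y z; apply: dsumP => i /=; rewrite addrA. Qed.
Lemma dsumDC : commutative dsumD.
Proof. by move=> x y; apply: dsumP => i /=; rewrite addrC. Qed.
Lemma dsumD0 : left_id dsum0 dsumD.
Proof. by move=> x; apply: dsumP => i /=; rewrite add0r. Qed.
Lemma dsumDN : left_inverse dsum0 dsumN dsumD.
Proof. by move=> x; apply: dsumP => i /=; rewrite addNr. Qed.

HB.instance Definition _ :=
  GRing.isZmodule.Build dsum dsumDA dsumDC dsumD0 dsumDN.

Lemma dsumZA a b x : dsumZ a (dsumZ b x) = dsumZ (a * b) x.
Proof. by apply: dsumP => i /=; rewrite scalerA. Qed.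
Lemma dsumZ1 : left_id 1 dsumZ.
Proof. by move=> x; apply: dsumP => i /=; rewrite scale1r. Qed.
Lemma dsumZDr : right_distributive dsumZ +%R.
Proof. by move=> a x y; apply: dsumP => i /=; rewrite scalerDr. Qed.
Lemma dsumZDl x : {morph dsumZ^~ x : a b / a + b}.
Proof. by move=> a b; apply: dsumP => i /=; rewrite scalerDl. Qed.

HB.instance Definition _ :=
  GRing.Zmodule_isLmodule.Build R dsum dsumZA dsumZ1 dsumZDr dsumZDl.

Lemma dsum0E i : (0 : dsum) i = 0. Proof. by []. Qed.
Lemma dsumDE (x y : dsum) i : (x + y) i = x i + y i. Proof. by []. Qed.
Lemma dsumNE (x : dsum) i : (- x) i = - x i. Proof. by []. Qed.
Lemma dsumZE a (x : dsum) i : (a *: x) i = a *: x i. Proof. by []. Qed.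

Definition dsum_coord i (x : dsum) : M i := x i.
Lemma coord_is_linear i : linear (dsum_coord i). Proof. by []. Qed.
HB.instance Definition _ i :=
  GRing.isLinear.Build R dsum (M i) _ (dsum_coord i) (coord_is_linear i).

End DirectSum.

Section DirectSumInjection.
Variables (R : pzRingType) (I : eqType) (M : I -> lmodType R).

Lemma dsum_inj_subproof i (x : M i) :
  finite_set [set j | dfwith (fun j => 0 : M j) x j != 0].
Proof.
apply: (sub_finite_set (B := [set i])); last exact: finite_set1.
move=> j /=; have [ij _|ij] := eqVneq i j; first exact/esym.
by rewrite dfwith_out ?eqxx.
Qed.

Definition dsum_inj i (x : M i) : dsum M := DSum (dsum_inj_subproof x).

End DirectSumInjection.

Section Image.
Variables (R : pzRingType) (U V : lmodType R) (f : {linear U -> V}).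

Definition im_pred : {pred V} := fun v => `[< exists u, f u = v >].

Lemma im_pred_closed : submod_closed im_pred.
Proof.
split=> [|a _ _ /asboolP[u <-] /asboolP[v <-]]; apply/asboolP.
  by exists 0; rewrite linear0.
by exists (a *: u + v); rewrite linearP.
Qed.

HB.instance Definition _ := GRing.isSubmodClosed.Build R V im_pred im_pred_closed.

Record im := Im { im_val :> V; im_valP : im_val \in im_pred }.

HB.instance Definition _ := [isSub for im_val].
HB.instance Definition _ := [Choice of im by <:].
HB.instance Definition _ := [SubChoice_isSubLmodule of im by <:].

Lemma im_pred_f u : f u \in im_pred.
Proof. by apply/asboolP; exists u. Qed.

End Image.

Section Span.
Variables (R : pzRingType) (V : lmodType R) (S : set V).

Definition span_pred : {pred V} := fun v =>
  `[< forall P : {pred V},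
        submod_closed P -> (forall s, S s -> s \in P) -> v \in P >].

Lemma span_pred_closed : submod_closed span_pred.
Proof.
split=> [|a u v /asboolP Pu /asboolP Pv]; apply/asboolP => P Pcl SP.
  by case: Pcl.
by case: (Pcl) => _; apply; [exact: Pu | exact: Pv].
Qed.

HB.instance Definition _ :=
  GRing.isSubmodClosed.Build R V span_pred span_pred_closed.

Lemma span_pred_sub s : S s -> s \in span_pred.
Proof. by move=> Ss; apply/asboolP => P _; exact. Qed.

End Span.

Section Quotient.
Variables (R : pzRingType) (V : lmodType R) (S : set V).
Import Quotient.
Local Open Scope quotient_scope.

Definition lquot := {quot span_pred S}.
HB.instance Definition _ := GRing.Zmodule.on lquot.

Definition lpi (v : V) : lquot := \pi_{quot span_pred S} v.

Lemma lpiP u v : (lpi u = lpi v) <-> (u - v \in span_pred S).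
Proof.
rewrite /lpi; split => [/eqP|uv]; rewrite ?idealrBE //.
by apply/eqP; rewrite -idealrBE.
Qed.

Lemma lpi_repr (q : lquot) : lpi (repr q) = q.
Proof. exact: reprK. Qed.

Lemma lpiD u v : lpi (u + v) = lpi u + lpi v.
Proof. exact: (raddfD \pi_{quot span_pred S}). Qed.

Definition lquotZ a (q : lquot) : lquot := lpi (a *: repr q).

Lemma lpiZ a v : lpi (a *: v) = lquotZ a (lpi v).
Proof. by apply/lpiP; rewrite -scalerBr rpredZ //; apply/lpiP; rewrite lpi_repr. Qed.

Lemma lquotZA a b x : lquotZ a (lquotZ b x) = lquotZ (a * b) x.
Proof. by rewrite -[x]lpi_repr -!lpiZ scalerA. Qed.
Lemma lquotZ1 : left_id 1 lquotZ.
Proof. by move=> x; rewrite -[x]lpi_repr -!lpiZ scale1r. Qed.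
Lemma lquotZDr : right_distributive lquotZ +%R.
Proof.
by move=> a x y; rewrite -[x]lpi_repr -[y]lpi_repr -lpiD -!lpiZ -lpiD scalerDr.
Qed.
Lemma lquotZDl x : {morph lquotZ^~ x : a b / a + b}.
Proof. by move=> a b; rewrite -[x]lpi_repr -!lpiZ -lpiD scalerDl. Qed.

HB.instance Definition _ := GRing.Zmodule_isLmodule.Build R lquot
  lquotZA lquotZ1 lquotZDr lquotZDl.

Lemma lpi_is_linear : linear lpi.
Proof. by move=> a u v; rewrite lpiD lpiZ. Qed.
HB.instance Definition _ := GRing.isLinear.Build R V lquot _ lpi lpi_is_linear.

End Quotient.

(* Associative R-algebras, not required to have a unit, and their left modules. *)
Record nualg (R : pzRingType) := NUAlg {
  nualg_sort :> lmodType R;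
  nmul : nualg_sort -> nualg_sort -> nualg_sort;
  nmulA : associative nmul;
  nmul_linear_l : forall b, linear (nmul^~ b);
  nmul_linear_r : forall a, linear (nmul a) }.

Record nmod (R : pzRingType) (A : nualg R) := NMod {
  nmod_sort :> lmodType R;
  nact : A -> nmod_sort -> nmod_sort;
  actA : forall a b v, nact a (nact b v) = nact (nmul a b) v;
  act_linear_l : forall v, linear (nact^~ v);
  act_linear_r : forall a, linear (nact a) }.

Section ModuleTheory.
Variables (R : pzRingType) (A : nualg R).
Implicit Types V W : nmod A.

HB.instance Definition _ V a :=
  GRing.isLinear.Build R V V _ (@nact R A V a) (act_linear_r a).

Definition equivariant V W (f : V -> W) := forall a v, f (nact a v) = nact a (f v).

(* Existence of some isomorphism of A-modules, with no map singled out. *)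
Definition nmod_isomorphic V W :=
  exists f : {linear V -> W}, equivariant f /\ bijective f.

Section DirectSumModule.
Variables (I : Type) (V : I -> nmod A).

Lemma dsum_act_subproof (a : A) (x : dsum V) :
  finite_set [set i | nact a (x i) != 0].
Proof.
apply: sub_finite_set (dsum_finite x) => i /=; apply: contra_neq => ->.
by rewrite linear0.
Qed.

Definition dsum_act a (x : dsum V) : dsum V := DSum (dsum_act_subproof a x).

Lemma dsum_actA a b x : dsum_act a (dsum_act b x) = dsum_act (nmul a b) x.
Proof. by apply: dsumP => i /=; rewrite actA. Qed.
Lemma dsum_act_linear_l x : linear (dsum_act^~ x).
Proof. by move=> r a b; apply: dsumP => i /=; rewrite act_linear_l. Qed.
Lemma dsum_act_linear_r a : linear (dsum_act a).
Proof. by move=> r x y; apply: dsumP => i /=; rewrite act_linear_r. Qed.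

Definition dsum_nmod : nmod A :=
  NMod dsum_actA dsum_act_linear_l dsum_act_linear_r.

End DirectSumModule.

Definition rmul (e a : A) : A := nmul a e.
HB.instance Definition _ e :=
  GRing.isLinear.Build R A A _ (rmul e) (nmul_linear_l e).

Definition lmul (e a : A) : A := nmul e a.
HB.instance Definition _ e :=
  GRing.isLinear.Build R A A _ (lmul e) (nmul_linear_r e).

(* Ae, eAe and eV as the images of a |-> ae, a |-> eae and v |-> ev. *)
Definition left_ideal (e : A) : lmodType R := im (rmul e).
Definition corner (e : A) : lmodType R := im (lmul e \o rmul e).
Definition truncation V (e : A) : lmodType R := im (@nact R A V e).

Lemma left_ideal_act_subproof e (a : A) (x : left_ideal e) :
  nmul a (im_val x) \in im_pred (rmul e).
Proof.
case: x => x /= /asboolP[b <-]; apply/asboolP; exists (nmul a b).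
by rewrite /rmul nmulA.
Qed.

Definition left_ideal_act e (a : A) (x : left_ideal e) : left_ideal e :=
  Im (left_ideal_act_subproof a x).

Lemma left_ideal_actA e a b (x : left_ideal e) :
  left_ideal_act a (left_ideal_act b x) = left_ideal_act (nmul a b) x.
Proof. by apply: val_inj => /=; rewrite nmulA. Qed.
Lemma left_ideal_act_linear_l e (x : left_ideal e) : linear (@left_ideal_act e ^~ x).
Proof. by move=> r a b; apply: val_inj => /=; rewrite nmul_linear_l. Qed.
Lemma left_ideal_act_linear_r e a : linear (@left_ideal_act e a).
Proof. by move=> r a' b; apply: val_inj => /=; rewrite nmul_linear_r. Qed.

HB.instance Definition _ e a := GRing.isLinear.Build R (left_ideal e)
  (left_ideal e) _ (@left_ideal_act e a) (@left_ideal_act_linear_r e a).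

Definition left_ideal_nmod e : nmod A :=
  NMod (@left_ideal_actA e) (@left_ideal_act_linear_l e)
       (@left_ideal_act_linear_r e).

Lemma left_ideal_ract_subproof e (x : left_ideal e) (b : corner e) :
  nmul (im_val x) (im_val b) \in im_pred (rmul e).
Proof.
case: b => b /= /asboolP[c <-]; apply/asboolP.
by exists (nmul (im_val x) (nmul e c)); rewrite /rmul /lmul /= !nmulA.
Qed.

Definition left_ideal_ract e (x : left_ideal e) (b : corner e) : left_ideal e :=
  Im (left_ideal_ract_subproof x b).

Lemma truncation_act_subproof V e (b : corner e) (v : truncation V e) :
  nact (im_val b) (im_val v) \in im_pred (@nact R A V e).
Proof.
case: b => b /= /asboolP[c <-]; apply/asboolP.
by exists (nact (nmul c e) (im_val v)); rewrite /rmul /lmul /= !actA.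
Qed.

Definition truncation_act V e (b : corner e) (v : truncation V e) :
  truncation V e := Im (truncation_act_subproof b v).

End ModuleTheory.

(* The tensor product over B of M and W, where B acts on M on the right by ra
   and on W on the left by la: the free R-module on M * W modulo R-bilinearity
   and (m b, w) ~ (m, b w). *)
Section Tensor.
Variables (R : comPzRingType) (M W : lmodType R) (B : Type).
Variables (ra : M -> B -> M) (la : B -> W -> W).

Definition free_tensor := dsum (fun _ : M * W => R^o : lmodType R).
HB.instance Definition _ := GRing.Lmodule.on free_tensor.

Definition free_pure (m : M) (w : W) : free_tensor :=
  dsum_inj (M := fun _ : M * W => R^o) (i := (m, w)) 1.

Inductive tensor_relation : set free_tensor :=
| tensor_addl m m' w :
    tensor_relation (free_pure (m + m') w - (free_pure m w + free_pure m' w))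
| tensor_addr m w w' :
    tensor_relation (free_pure m (w + w') - (free_pure m w + free_pure m w'))
| tensor_scalel r m w :
    tensor_relation (free_pure (r *: m) w - r *: free_pure m w)
| tensor_scaler r m w :
    tensor_relation (free_pure m (r *: w) - r *: free_pure m w)
| tensor_balanced m b w :
    tensor_relation (free_pure (ra m b) w - free_pure m (la b w)).

Definition tensor : lmodType R := lquot tensor_relation.

Definition free_tensor_map (f : M -> M) (x : free_tensor) : free_tensor :=
  \sum_(p \in [set: M * W]) x p *: free_pure (f p.1) p.2.

Lemma free_tensor_map_is_linear f : linear (free_tensor_map f).
Proof.
move=> a x y; rewrite /free_tensor_map -fsumTP.
- by apply: eq_fsbigr => p _; rewrite dsumDE dsumZE scalerDl scalerA.
- apply: sub_finite_set (dsum_finite x) => p /=; apply: contra_neq => ->.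
  by rewrite scale0r.
- apply: sub_finite_set (dsum_finite y) => p /=; apply: contra_neq => ->.
  by rewrite scale0r.
Qed.

HB.instance Definition _ f := GRing.isLinear.Build R free_tensor free_tensor _
  (free_tensor_map f) (free_tensor_map_is_linear f).

Lemma free_tensor_map_pure f m w :
  free_tensor_map f (free_pure m w) = free_pure (f m) w.
Proof.
rewrite /free_tensor_map (@fsumTE _ _ [:: (m, w)]) //.
  by rewrite big_seq1 /= dfwith_in scale1r.
move=> p; rewrite inE => np; rewrite /= dfwith_out ?scale0r //.
by rewrite eq_sym.
Qed.

Section TensorMap.
Variable f : {linear M -> M}.
Hypothesis fra : forall m b, f (ra m b) = ra (f m) b.

Lemma free_tensor_map_span x : x \in span_pred tensor_relation ->
  free_tensor_map f x \in span_pred tensor_relation.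
Proof.
pose P : {pred free_tensor} :=
  fun x => free_tensor_map f x \in span_pred tensor_relation.
move/asboolP/(_ P); apply.
  split=> [|a u v hu hv]; rewrite -[_ \in P]/(free_tensor_map f _ \in _).
    by rewrite linear0 rpred0.
  by rewrite linearP; apply: rpredD => //; apply: rpredZ.
move=> _ [m m' w|m w w'|r m w|r m w|m b w];
  rewrite -[_ \in P]/(free_tensor_map f _ \in _); apply: span_pred_sub;
  rewrite linearB ?linearD ?linearZ /= !free_tensor_map_pure -?opprD ?scalerN.
- by rewrite linearD; exact: tensor_addl.
- exact: tensor_addr.
- by rewrite linearZ; exact: tensor_scalel.
- exact: tensor_scaler.
- by rewrite fra; exact: tensor_balanced.
Qed.

Definition tensor_map (t : tensor) : tensor := lpi _ (free_tensor_map f (repr t)).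

Lemma tensor_map_lpi x : tensor_map (lpi _ x) = lpi _ (free_tensor_map f x).
Proof.
apply/lpiP; rewrite -linearB; apply: free_tensor_map_span; apply/lpiP.
exact: lpi_repr.
Qed.

Lemma tensor_map_is_linear : linear tensor_map.
Proof.
move=> a x y; rewrite -[x]lpi_repr -[y]lpi_repr -linearP !tensor_map_lpi.
by rewrite !linearP.
Qed.

End TensorMap.

Definition pure (m : M) (w : W) : tensor := lpi _ (free_pure m w).

Lemma lpi_free_tensor_map (f : M -> M) (x : free_tensor) :
  lpi tensor_relation (free_tensor_map f x) =
  \sum_(p \in [set: M * W]) x p *: pure (f p.1) p.2.
Proof.
have [s us s0] := finite_supp (dsum_finite x) (fun i => id).
rewrite /free_tensor_map !(@fsumTE _ _ s) //; try by move=> p /s0 ->; rewrite scale0r.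
by rewrite linear_sum; apply: eq_bigr => p _; rewrite linearZ.
Qed.

Lemma free_tensor_map_comp (f g : M -> M) (x : free_tensor) :
  free_tensor_map f (free_tensor_map g x) = free_tensor_map (f \o g) x.
Proof.
have [s us s0] := finite_supp (dsum_finite x) (fun i => id).
rewrite [free_tensor_map g x]/free_tensor_map [RHS]/free_tensor_map.
rewrite !(@fsumTE _ _ s) //; try by move=> p /s0 ->; rewrite scale0r.
rewrite linear_sum; apply: eq_bigr => p _.
by rewrite linearZ /= free_tensor_map_pure.
Qed.

Lemma pureP_l r m m' w : pure (r *: m + m') w = r *: pure m w + pure m' w.
Proof.
have -> : pure (r *: m + m') w = pure (r *: m) w + pure m' w.
  by rewrite /pure -lpiD; apply/lpiP; apply: span_pred_sub; exact: tensor_addl.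
congr (_ + _); rewrite /pure -[RHS]lpiZ; apply/lpiP; apply: span_pred_sub.
exact: tensor_scalel.
Qed.

End Tensor.

Section InducedModule.
Variables (R : comPzRingType) (A : nualg R) (V : nmod A) (e : A).

(* Ae (x)_{eAe} eV, on which A acts through the left factor. *)
Definition ind : lmodType R :=
  tensor (@left_ideal_ract R A e) (@truncation_act R A V e).

Lemma left_ideal_act_ract a (x : left_ideal e) (b : corner e) :
  left_ideal_act a (left_ideal_ract x b) = left_ideal_ract (left_ideal_act a x) b.
Proof. by apply: val_inj => /=; rewrite nmulA. Qed.

Definition ind_act (a : A) : ind -> ind := tensor_map (left_ideal_act a).

Lemma ind_act_lpi a x :
  ind_act a (lpi _ x) = lpi _ (free_tensor_map (left_ideal_act a) x).
Proof. exact/tensor_map_lpi/left_ideal_act_ract. Qed.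

Lemma ind_actA a b t : ind_act a (ind_act b t) = ind_act (nmul a b) t.
Proof.
rewrite -[t]lpi_repr !ind_act_lpi free_tensor_map_comp; congr (lpi _ _).
by apply: eq_fsbigr => p _ /=; rewrite left_ideal_actA.
Qed.

Lemma ind_act_linear_l t : linear (ind_act^~ t).
Proof.
move=> r a b; rewrite -[t]lpi_repr !ind_act_lpi !lpi_free_tensor_map.
set x := repr t; have [s us s0] := finite_supp (dsum_finite x) (fun i => id).
rewrite !(@fsumTE _ _ s) //; try by move=> p /s0 ->; rewrite scale0r.
rewrite scaler_sumr -big_split; apply: eq_bigr => p _ /=.
rewrite left_ideal_act_linear_l pureP_l scalerDr !scalerA.
by rewrite mulrC.
Qed.

Lemma ind_act_linear_r a : linear (ind_act a).
Proof. exact/tensor_map_is_linear/left_ideal_act_ract. Qed.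

Definition ind_nmod : nmod A :=
  NMod ind_actA ind_act_linear_l ind_act_linear_r.

End InducedModule.

(* R-linear categories whose set of objects is nat. *)
Record lincat (R : pzRingType) := LinCat {
  lhom :> nat -> nat -> lmodType R;
  id_mor : forall n, lhom n n;
  hcomp : forall l m n, lhom m n -> lhom l m -> lhom l n;
  hcompA : forall k l m n (f : lhom m n) (g : lhom l m) (h : lhom k l),
    hcomp f (hcomp g h) = hcomp (hcomp f g) h;
  comp1m : forall m n (f : lhom m n), hcomp (id_mor n) f = f;
  compm1 : forall m n (f : lhom m n), hcomp f (id_mor m) = f;
  comp_linear_l : forall l m n (g : lhom l m), linear (fun f : lhom m n => hcomp f g);
  comp_linear_r : forall l m n (f : lhom m n), linear (fun g : lhom l m => hcomp f g) }.

Section CategoryAlgebra.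
Variables (R : pzRingType) (C : lincat R).

HB.instance Definition _ l m n (f : C m n) := GRing.isLinear.Build R (C l m)
  (C l n) _ (hcomp f : C l m -> C l n) (@comp_linear_r _ C l m n f).

Definition hcomp_r l m n (g : C l m) (f : C m n) : C l n := hcomp f g.
HB.instance Definition _ l m n (g : C l m) := GRing.isLinear.Build R (C m n)
  (C l n) _ (@hcomp_r l m n g) (@comp_linear_l _ C l m n g).

Lemma comp0m l m n (g : C l m) : hcomp (0 : C m n) g = 0.
Proof. exact: (linear0 (@hcomp_r l m n g)). Qed.

Lemma compm0 l m n (f : C m n) : hcomp f (0 : C l m) = 0.
Proof. exact: linear0. Qed.

(* The component of x at (m, n) is the part of x in Hom(m, n). *)
Definition catalg_sort : lmodType R := dsum (fun p : nat * nat => C p.1 p.2).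

Implicit Types x y z : dsum (fun p : nat * nat => C p.1 p.2).

Definition part x m n : C m n := x (m, n).

Lemma partP r x y m n : part (r *: x + y) m n = r *: part x m n + part y m n.
Proof. by []. Qed.

Definition catalg_mul_fun x y (p : nat * nat) : C p.1 p.2 :=
  \sum_(m \in [set: nat]) hcomp (part x m p.2) (part y p.1 m).

Lemma dsum_bound x : exists N, forall m n, (N <= m)%N || (N <= n)%N -> part x m n = 0.
Proof.
have /finite_seqP[s sE] := dsum_finite x.
exists (\max_(p <- s) (maxn p.1 p.2).+1)%N => m n mn.
apply/eqP/negPn/negP => xmn.
have /(@leq_bigmax_seq _ s xpredT (fun p => (maxn p.1 p.2).+1)) : (m, n) \in s.
  by rewrite -[is_true _]/([set` s] (m, n)) -sE.
move=> /(_ isT) /=; apply/negP; rewrite -ltnNge ltnS leq_max.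
by case/orP: mn => ->; rewrite ?orbT.
Qed.

Lemma fsum_nat (V : zmodType) N (F : nat -> V) :
  (forall m, (N <= m)%N -> F m = 0) ->
  \sum_(m \in [set: nat]) F m = \sum_(m < N) F m.
Proof.
move=> F0; rewrite (@fsumTE _ _ (iota 0 N)) ?iota_uniq //.
  by rewrite -[RHS](big_mkord xpredT F) /index_iota subn0.
by move=> m; rewrite mem_iota add0n /= -leqNgt; exact: F0.
Qed.

Lemma catalg_mul_subproof x y : finite_set [set p | catalg_mul_fun x y p != 0].
Proof.
have [M xM] := dsum_bound x; have [N yN] := dsum_bound y.
apply: (sub_finite_set (B := [set` [seq (m, n) | m <- iota 0 N, n <- iota 0 M]])).
  case=> l n /= ln0; rewrite allpairs_f // mem_iota add0n leq0n ltnNge /=.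
    apply: contraNN ln0 => Nl; apply/eqP; rewrite /catalg_mul_fun fsbig1 //= => m _.
    by rewrite yN ?Nl // compm0.
  apply: contraNN ln0 => Mn; apply/eqP; rewrite /catalg_mul_fun fsbig1 //= => m _.
  by rewrite xM ?Mn ?orbT // comp0m.
exact: finite_seq.
Qed.

Definition catalg_mul x y : dsum (fun p : nat * nat => C p.1 p.2) :=
  DSum (catalg_mul_subproof x y).

Lemma catalg_mulE N x y l n :
  (forall m, (N <= m)%N -> hcomp (part x m n) (part y l m) = 0) ->
  part (catalg_mul x y) l n = \sum_(m < N) hcomp (part x (val m) n) (part y l (val m)).
Proof. exact: fsum_nat. Qed.

Lemma catalg_mulA : associative catalg_mul.
Proof.
move=> x y z; have [N yN] := dsum_bound y; apply: dsumP => -[k n].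
rewrite -[LHS]/(part _ k n) -[RHS]/(part _ k n).
rewrite (@catalg_mulE N); last first.
  move=> m Nm; rewrite (@catalg_mulE 0) ?big_ord0 ?compm0 // => l _.
  by rewrite yN ?Nm ?orbT // comp0m.
rewrite [RHS](@catalg_mulE N); last first.
  move=> m Nm; rewrite (@catalg_mulE 0) ?big_ord0 ?comp0m // => l _.
  by rewrite yN ?Nm // compm0.
under eq_bigr => m _.
  rewrite (@catalg_mulE N); last by move=> l Nl; rewrite yN ?Nl // comp0m.
  rewrite linear_sum; over.
under [RHS]eq_bigr => m _.
  rewrite (@catalg_mulE N); last by move=> l Nl; rewrite yN ?Nl ?orbT // compm0.
  rewrite -[hcomp _ _]/(hcomp_r _ _) linear_sum; over.
rewrite exchange_big; apply: eq_bigr => m _; apply: eq_bigr => l _ /=.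
by rewrite /hcomp_r hcompA.
Qed.

Lemma catalg_mul_linear_l y : linear (catalg_mul^~ y).
Proof.
move=> a x x'; have [N yN] := dsum_bound y.
apply: dsumP => -[l n]; rewrite -[LHS]/(part _ l n) -[RHS]/(part _ l n) partP.
have H u m : (N <= m)%N -> hcomp (part u m n) (part y l m) = 0 :> C l n.
  by move=> Nm; rewrite yN ?Nm ?orbT // compm0.
rewrite !(@catalg_mulE N) //; try exact: H.
rewrite scaler_sumr -big_split; apply: eq_bigr => m _ /=.
exact: comp_linear_l.
Qed.

Lemma catalg_mul_linear_r x : linear (catalg_mul x).
Proof.
move=> a y y'; have [N xN] := dsum_bound x.
apply: dsumP => -[l n]; rewrite -[LHS]/(part _ l n) -[RHS]/(part _ l n) partP.
have H (u : dsum (fun p : nat * nat => C p.1 p.2)) m :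
    (N <= m)%N -> hcomp (part x m n) (part u l m) = 0 :> C l n.
  by move=> Nm; rewrite xN ?Nm // comp0m.
rewrite !(@catalg_mulE N) //; try exact: H.
rewrite scaler_sumr -big_split; apply: eq_bigr => m _ /=.
exact: comp_linear_r.
Qed.

Definition catalg : nualg R :=
  @NUAlg R catalg_sort catalg_mul catalg_mulA catalg_mul_linear_l
    catalg_mul_linear_r.

(* e_n and e_{m,n} = e_m + ... + e_n *)
Definition idem (n : nat) : catalg :=
  dsum_inj (M := fun p : nat * nat => C p.1 p.2) (i := (n, n)) (id_mor C n).

Definition idems (m n : nat) : catalg := \sum_(m <= i < n.+1) idem i.

End CategoryAlgebra.

Arguments part : simpl never.

Section GradedModules.
Variables (R : comPzRingType) (C : lincat R).
Implicit Type V : nmod (catalg C).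

(* V is the internal direct sum of the submodules e_n V. *)
Definition graded V : Prop :=
  bijective (fun w : dsum (fun n => truncation V (idem C n)) =>
    \sum_(n \in [set: nat]) im_val (w n)).

Definition presented_in_degree V (N : nat) : Prop :=
  let P := left_ideal_nmod (idems C 0 N) in
  exists (I J : Type)
    (f : {linear dsum_nmod (fun _ : J => P) -> dsum_nmod (fun _ : I => P)})
    (g : {linear dsum_nmod (fun _ : I => P) -> V}),
  [/\ equivariant f, equivariant g,
      range f = [set x | g x = 0] & range g = [set: V]].

Definition presented_in_finite_degrees V : Prop :=
  exists N, presented_in_degree V N.

Lemma prd_subproof V : presented_in_finite_degrees V ->
  exists N, `[< presented_in_degree V N >].
Proof. by case=> N VN; exists N; apply/asboolP. Qed.

Definition prd V (Vfp : presented_in_finite_degrees V) : nat :=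
  ex_minn (prd_subproof Vfp).

Definition centrally_stable V : Prop :=
  exists N0, forall N, (N0 <= N)%N ->
    nmod_isomorphic (ind_nmod V (idems C 0 N)) V.

End GradedModules.

(* Main.v *)
(* For e = e_{0,N} the following are equivalent: V is presented by copies of Ae;
   the multiplication map mu : Ae (x)_{eAe} eV -> V is bijective; V is isomorphic
   to Ae (x)_{eAe} eV by some map.  If g is a surjection from the free module on
   copies of Ae onto V whose kernel is generated by its e-part, then
   x |-> sum_i x_i (x) g(e delta_i) maps the free module onto Ae (x)_{eAe} eV,
   kills ker g and lifts g along mu, so mu is injective.  Conversely
   Ae (x)_{eAe} eV is itself presented by copies of Ae: the tensor relations are
   Ae-multiples of elements of the kernel of x |-> sum_w x_w (x) w.  Finally,
   bijectivity of mu passes from e_{0,M} to e_{0,N} for M <= N, because every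
   tensor over the larger corner is a sum of tensors m (x) w with m in Ae and
   w in eV, e = e_{0,M}. *)

Require Import Defs.
From mathcomp Require Import all_boot all_algebra.
From HB Require Import structures.
From mathcomp Require Import boolp classical_sets cardinality fsbigop.

Set Implicit Arguments.
Unset Strict Implicit.
Unset Printing Implicit Defensive.

Import GRing.Theory.
Local Open Scope classical_set_scope.
Local Open Scope ring_scope.

(** * Linear maps and bijections from bare functions *)

Lemma linear_bundle (R : pzRingType) (U V : lmodType R) (f : U -> V) :
  linear f -> exists g : {linear U -> V}, g =1 f.
Proof.
move=> fl; pose fL := GRing.isLinear.Build R U V _ f fl.
by exists (HB.pack f fL : {linear U -> V}).
Qed.

Lemma inj_surj_bijective (T U : Type) (f : T -> U) :
  injective f -> (forall y, exists x, f x = y) -> bijective f.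
Proof.
move=> fI fS; pose g y := sval (cid (fS y)).
have gK : cancel g f by move=> y; rewrite /g; case: cid.
by exists g => // x; apply: fI; rewrite gK.
Qed.

(** * Induction and universal property for direct sums *)

Section DirectSum.
Variables (R : pzRingType) (I : choiceType) (M : I -> lmodType R).
Implicit Types x y : dsum M.

Lemma dsum_injE i (m : M i) : dsum_inj m i = m.
Proof. exact: dfwith_in. Qed.

Lemma dsum_inj_out i j (m : M i) : i != j -> dsum_inj m j = 0.
Proof. exact: dfwith_out. Qed.

Lemma dsum_inj_is_linear i : linear (@dsum_inj R I M i).
Proof.
move=> a x y; apply: dsumP => j; rewrite dsumDE dsumZE.
have [<-|ij] := eqVneq i j; first by rewrite !dsum_injE.
by rewrite !dsum_inj_out // scaler0 addr0.
Qed.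
HB.instance Definition _ i := GRing.isLinear.Build R (M i) (dsum M) _
  (@dsum_inj R I M i) (@dsum_inj_is_linear i).

Lemma dsum_supp x : exists2 s : seq I, uniq s & forall i, i \notin s -> x i = 0.
Proof.
have /finite_seqP[s sE] := dsum_finite x.
exists (undup s) => [|i]; first exact: undup_uniq.
rewrite mem_undup => /negP si; apply/eqP/negPn/negP => xi; apply: si.
by rewrite -[is_true _]/([set` s] i) -sE.
Qed.

Lemma dsum_ind (P : dsum M -> Prop) :
  P 0 -> (forall x y, P x -> P y -> P (x + y)) ->
  (forall i (m : M i), P (dsum_inj m)) -> forall x, P x.
Proof.
move=> P0 PD Pinj x; have [s us s0] := dsum_supp x.
(* An element is the finite sum of its components over a list containing its support. *)
have -> : x = \sum_(i <- s) dsum_inj (x i).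
  apply: dsumP => j; rewrite -[RHS]/(dsum_coord j _) linear_sum.
  have [js|js] := boolP (j \in s); last first.
    rewrite s0 // big_seq big1 // => i si; apply: dsum_inj_out.
    by apply: contraNneq js => <-.
  rewrite (bigD1_seq j) // big1 => [|i ij]; last exact: dsum_inj_out.
  by rewrite [RHS]addr0 [RHS]dsum_injE.
by elim/big_ind: _.
Qed.

Lemma dsum_universal (U : lmodType R) (phi : forall i, {linear M i -> U}) :
  exists f : {linear dsum M -> U}, forall i (m : M i), f (dsum_inj m) = phi i m.
Proof.
pose f x : U := \sum_(i \in [set: I]) phi i (x i).
have supp x : finite_set [set i | phi i (x i) != 0].
  apply: sub_finite_set (dsum_finite x) => i /=; apply: contra_neq => ->.
  exact: linear0.
have [|g gE] := @linear_bundle R (dsum M) U f.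
  move=> a x y; rewrite /f -fsumTP //.
  by apply: eq_fsbigr => i _; rewrite linearP.
exists g => i m; rewrite gE /f (@fsumTE _ _ [:: i]) //.
  by rewrite big_seq1 dsum_injE.
by move=> j; rewrite inE eq_sym => ij; rewrite dsum_inj_out ?linear0.
Qed.

End DirectSum.

(** * Universal properties of quotients and tensor products *)

(** The kernel of [h] is a submodule containing [S], hence contains its span; so evaluating [h] at a
    chosen representative is independent of the choice. *)
Lemma lquot_universal (R : pzRingType) (V U : lmodType R) (S : set V)
    (h : {linear V -> U}) :
  (forall s, S s -> h s = 0) ->
  exists f : {linear lquot S -> U}, forall v, f (lpi S v) = h v.
Proof.
move=> hS.
have h0 v : v \in span_pred S -> h v = 0.
  move=> /asboolP /(_ (fun v => h v == 0)) => vS; apply/eqP/vS.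
    split=> [|a x y /eqP hx /eqP hy]; rewrite -[_ \in _]/(_ == 0).
      by rewrite linear0.
    by rewrite linearP hx hy scaler0 addr0.
  by move=> s /hS hs; apply/eqP.
pose f (q : lquot S) := h (repr q).
have fE v : f (lpi S v) = h v.
  apply/eqP; rewrite -subr_eq0 -linearB; apply/eqP/h0/lpiP.
  exact: lpi_repr.
have [|g gE] := @linear_bundle R (lquot S) U f.
  by move=> a x y; rewrite -[x]lpi_repr -[y]lpi_repr -linearP !fE linearP.
by exists g => v; rewrite gE.
Qed.

Section Tensor.
Variables (R : comPzRingType) (M W : lmodType R) (B : Type).
Variables (ra : M -> B -> M) (la : B -> W -> W).
Local Notation pure := (pure ra la).

Lemma pureZl r m w : pure (r *: m) w = r *: pure m w.
Proof. by rewrite /pure -linearZ; apply/lpiP/span_pred_sub/tensor_scalel. Qed.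

Lemma pureDr m w w' : pure m (w + w') = pure m w + pure m w'.
Proof. by rewrite /pure -lpiD; apply/lpiP/span_pred_sub/tensor_addr. Qed.

Lemma pureZr r m w : pure m (r *: w) = r *: pure m w.
Proof. by rewrite /pure -linearZ; apply/lpiP/span_pred_sub/tensor_scaler. Qed.

Lemma pure0r m : pure m 0 = 0.
Proof. by rewrite -(scale0r 0) pureZr scale0r. Qed.

Lemma pure_balanced m b w : pure (ra m b) w = pure m (la b w).
Proof. by apply/lpiP/span_pred_sub/tensor_balanced. Qed.

Lemma tensor_ind (P : tensor ra la -> Prop) :
  P 0 -> (forall x y, P x -> P y -> P (x + y)) ->
  (forall m w, P (pure m w)) -> forall t, P t.
Proof.
move=> P0 PD Pp t; rewrite -[t]lpi_repr; move: (repr t).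
apply: dsum_ind => [|x y Px Py|[m w] r].
- by rewrite linear0.
- by rewrite linearD; exact: PD.
(* [P] is not assumed stable under scaling, so the coefficient [r] is absorbed into the left
   factor. *)
- suff -> : dsum_inj (M := fun _ : M * W => R^o) (i := (m, w)) r = r *: free_pure m w.
    by rewrite linearZ -[X in P X]/(r *: pure m w) -pureZl.
  by rewrite -linearZ /= /GRing.scale /= mulr1.
Qed.

Lemma tensor_universal (U : lmodType R) (phi : M -> W -> U) :
  (forall w, linear (phi^~ w)) -> (forall m, linear (phi m)) ->
  (forall m b w, phi (ra m b) w = phi m (la b w)) ->
  exists f : {linear tensor ra la -> U}, forall m w, f (pure m w) = phi m w.
Proof.
move=> phil phir phib.
have philD m m' w : phi (m + m') w = phi m w + phi m' w.
  by have := phil w 1 m m'; rewrite !scale1r.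
have phirD m w w' : phi m (w + w') = phi m w + phi m w'.
  by have := phir m 1 w w'; rewrite !scale1r.
have phi0l w : phi 0 w = 0 by apply: (addrI (phi 0 w)); rewrite -philD !addr0.
have phi0r m : phi m 0 = 0 by apply: (addrI (phi m 0)); rewrite -phirD !addr0.
(* The free module has one copy of [R] per pair [p]; on that copy the map must be r |-> r phi(p). *)
have /choice[psi psiE] p : exists f : {linear R^o -> U}, forall r, f r = r *: phi p.1 p.2.
  have [|f fE] := @linear_bundle R R^o U (fun r => r *: phi p.1 p.2).
    by move=> a r s; rewrite scalerDl scalerA.
  by exists f.
have [h hE] := dsum_universal psi.
have {psiE} hE m w : h (free_pure m w) = phi m w by rewrite hE psiE scale1r.
have [|f fE] := @lquot_universal R _ U (tensor_relation ra la) h.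
  move=> _ [m m' w|m w w'|r m w|r m w|m b w];
    apply/eqP; rewrite linearB subr_eq0 ?linearD ?linearZ /= !hE; apply/eqP.
  - exact: philD.
  - exact: phirD.
  - by have := phil w r m 0; rewrite !addr0 phi0l addr0.
  - by have := phir m r w 0; rewrite !addr0 phi0r addr0.
  - exact: phib.
by exists f => m w; rewrite fE.
Qed.

End Tensor.

(** * The induced module and its multiplication map *)

Section InducedModule.
Variables (R : comPzRingType) (A : nualg R).
Implicit Types V W : nmod A.

Lemma nact0r V a : nact a (0 : V) = 0. Proof. exact: linear0. Qed.

Lemma nactDr V a (v w : V) : nact a (v + w) = nact a v + nact a w.
Proof. exact: linearD. Qed.

Variable e : A.
Hypothesis ee : nmul e e = e.

Local Notation Ae := (left_ideal_nmod e).
Local Notation pure V :=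
  (pure (@left_ideal_ract R A e) (@truncation_act R A V e)).

Lemma left_ideal_fix (m : left_ideal e) : nmul (im_val m) e = im_val m.
Proof. by case: m => m /= /asboolP[a <-]; rewrite /rmul -nmulA ee. Qed.

Lemma truncation_fix V (w : truncation V e) : nact e (im_val w) = im_val w.
Proof. by case: w => w /= /asboolP[v <-]; rewrite actA ee. Qed.

(** The generator e of Ae. As an image under right multiplication by e its value is ee, which is e
    by idempotency. *)
Definition left_ideal_gen : left_ideal e := Im (im_pred_f (rmul e) e).

Lemma left_ideal_genE : im_val left_ideal_gen = e. Proof. exact: ee. Qed.

Lemma left_ideal_act_gen (m : left_ideal e) :
  left_ideal_act (im_val m) left_ideal_gen = m.
Proof. by apply: val_inj; rewrite /= /rmul ee left_ideal_fix. Qed.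

Definition trunc V (v : V) : truncation V e := Im (im_pred_f (@nact R A V e) v).

Lemma im_val_trunc V (v : V) : im_val (trunc v) = nact e v. Proof. by []. Qed.

Lemma trunc_im_val V (w : truncation V e) : trunc (im_val w) = w.
Proof. by apply: val_inj; rewrite /= truncation_fix. Qed.

Lemma truncD V (v w : V) : trunc (v + w) = trunc v + trunc w.
Proof. by apply: val_inj; rewrite /= nactDr. Qed.

Lemma trunc0 V : trunc (0 : V) = 0.
Proof. by apply: val_inj; rewrite /= nact0r. Qed.

Lemma ind_act_pure V a m (w : truncation V e) :
  nact (n := ind_nmod V e) a (pure V m w) = pure V (left_ideal_act a m) w.
Proof.
by rewrite /Defs.pure -free_tensor_map_pure; exact: ind_act_lpi.
Qed.

(** Since m = me and w = ew, the hypotheses say m' = m(eae) and w' = (eae)w, so eae crosses the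
    tensor sign. Stating this on underlying values spares building corner elements. *)
Lemma ind_balanced V a (m m' : left_ideal e) (w w' : truncation V e) :
  im_val m' = nmul (im_val m) (nmul a e) ->
  im_val w' = nact e (nact a (im_val w)) -> pure V m' w = pure V m w'.
Proof.
move=> mm' ww'; pose b : corner e := Im (im_pred_f (lmul e \o rmul e) a).
have -> : m' = left_ideal_ract m b.
  by apply: val_inj; rewrite /= mm' /lmul /rmul [RHS]nmulA left_ideal_fix.
have -> : w' = truncation_act b w.
  apply: val_inj; rewrite /= ww' /lmul /rmul -[in LHS](truncation_fix w).
  by rewrite !actA !nmulA.
exact: pure_balanced.
Qed.

Definition is_mult_map V (mu : ind_nmod V e -> V) :=
  forall m w, mu (pure V m w) = nact (im_val m) (im_val w).

Lemma mult_map_exists V : exists mu : {linear ind_nmod V e -> V}, is_mult_map mu.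
Proof.
apply: tensor_universal => [w a m m'|m a w w'|m b w].
- exact: act_linear_l.
- exact: act_linear_r.
- by rewrite /= actA.
Qed.

Lemma mult_map_equivariant V (mu : {linear ind_nmod V e -> V}) :
  is_mult_map mu -> equivariant mu.
Proof.
move=> muE a; apply: tensor_ind => [|x y mux muy|m w].
- by rewrite !linear0.
- by rewrite !linearD mux muy.
- by rewrite ind_act_pure !muE /= actA.
Qed.

Definition mult_map_bijective V :=
  exists2 mu : {linear ind_nmod V e -> V}, is_mult_map mu & bijective mu.

Lemma mult_map_isomorphic V : mult_map_bijective V -> nmod_isomorphic (ind_nmod V e) V.
Proof. by case=> mu /mult_map_equivariant muA mub; exists mu. Qed.

Definition free_nmod (I : Type) : nmod A := dsum_nmod (fun _ : I => Ae).

(** * Direct sums of copies of Ae *)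

Section Free.
Variable I : choiceType.

Definition delta (i : I) (m : left_ideal e) : free_nmod I :=
  @dsum_inj R I (fun _ => Ae) i m.

Lemma free_ind (P : free_nmod I -> Prop) :
  P 0 -> (forall x y, P x -> P y -> P (x + y)) ->
  (forall i m, P (delta i m)) -> forall x, P x.
Proof. exact: dsum_ind. Qed.

Lemma nact_delta a i m : nact a (delta i m) = delta i (left_ideal_act a m).
Proof.
apply: dsumP => j; rewrite -[LHS]/(nact a (delta i m j)).
have [<-|ij] := eqVneq i j; first by rewrite !dsum_injE.
by rewrite !dsum_inj_out // linear0.
Qed.

Lemma delta_gen i m : delta i m = nact (im_val m) (delta i left_ideal_gen).
Proof. by rewrite nact_delta left_ideal_act_gen. Qed.

(** The vectors [v i] may lie outside eV: the generator of the i-th copy is sent to e [v i]. *)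
Lemma free_universal V (v : I -> V) :
  exists2 f : {linear free_nmod I -> V},
    equivariant f & forall i m, f (delta i m) = nact (im_val m) (v i).
Proof.
have /choice[phi phiE] i :
    exists f : {linear Ae -> V}, forall m : Ae, f m = nact (im_val m) (v i).
  have [|f fE] := @linear_bundle R Ae V (fun m : Ae => nact (im_val m) (v i)).
    by move=> a m m'; exact: act_linear_l.
  by exists f.
have [f fE] := dsum_universal phi.
have {phiE}fE i m : f (delta i m) = nact (im_val m) (v i) by rewrite fE phiE.
exists f => // a; apply: free_ind => [|x y fx fy|i m].
- by rewrite nact0r !linear0.
- by rewrite nactDr !linearD fx fy.
- by rewrite nact_delta !fE /= actA.
Qed.

End Free.

(** * Presentations by copies of Ae *)

(** For e = e_{0,N} this is [presented_in_degree V N]; the general form separates the argument from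
    the category algebra. *)
Definition presented_by V := exists (I J : Type)
    (f : {linear free_nmod J -> free_nmod I}) (g : {linear free_nmod I -> V}),
  [/\ equivariant f, equivariant g,
      range f = [set x | g x = 0] & range g = [set: V]].

Lemma presented_by_isomorphic V W :
  nmod_isomorphic V W -> presented_by V -> presented_by W.
Proof.
move=> [h [hA hb]] [I [J [f [g [fA gA fg gS]]]]].
exists I, J, f, (h \o g : {linear _ -> _}); split => //.
- by move=> a x /=; rewrite gA hA.
- rewrite fg; apply/seteqP; split=> x /= => [->|hgx]; first exact: linear0.
  by apply: (bij_inj hb); rewrite hgx linear0.
- apply/seteqP; split=> // w _; case: hb => h' hK h'K.
  have /= [x _ gx] : range g (h' w) by rewrite gS.
  by exists x => //=; rewrite gx h'K.
Qed.

Lemma mult_map_bijective_of_presented V : presented_by V -> mult_map_bijective V.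
Proof.
(* The index types are arbitrary; classical logic supplies the decidable equality needed for the
   injections into direct sums. *)
case=> I0 [J0 []]; pose I : choiceType := {classic I0}.
pose J : choiceType := {classic J0}; rewrite -[I0]/(I : Type) -[J0]/(J : Type).
move=> f [g [fA gA fg gS]].
have [mu muE] := mult_map_exists V; exists mu => //.
have muA := mult_map_equivariant muE.
have surj v : exists x, g x = v.
  have [x _ gx] : range g v by rewrite gS.
  by exists x.
pose gen i : ind_nmod V e := pure V left_ideal_gen (trunc (g (delta i left_ideal_gen))).
have [s sA sE] := free_universal gen.
have mus x : mu (s x) = g x.
  elim/free_ind: x => [|x y hx hy|i m]; rewrite ?linear0 ?linearD ?hx ?hy //.
  rewrite sE muA muE left_ideal_genE im_val_trunc -!gA !nact_delta; congr (g (delta _ _)).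
  by apply: val_inj; rewrite /= /rmul !ee left_ideal_fix.
(* An element e z of the free module has its coefficients in eAe. *)
have se z : s (nact e z) = pure V left_ideal_gen (trunc (g z)).
  elim/free_ind: z => [|x y hx hy|i m].
  - by rewrite nact0r !linear0 trunc0 pure0r.
  - by rewrite nactDr !linearD hx hy truncD pureDr.
  rewrite sA sE !ind_act_pure; apply: (@ind_balanced _ (im_val m)).
    by rewrite /= /rmul ee.
  by rewrite !im_val_trunc delta_gen gA [in RHS](actA (im_val m)) left_ideal_fix.
(* The kernel of g is the image of f, generated by f(delta_j e) = e f(delta_j e). These are
   e-multiples, so [se] computes s on them as e (x) e g(f(..)) = 0. *)
have skerg x : g x = 0 -> s x = 0.
  move=> gx; have [y _ <-] : range f x by rewrite fg.
  have gf z : g (f z) = 0.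
    have : range f (f z) by exists z.
    by rewrite fg.
  elim/free_ind: y => [|y z hy hz|j m]; first by rewrite !linear0.
    by rewrite !linearD hy hz addr0.
  rewrite delta_gen fA sA -[left_ideal_gen]left_ideal_act_gen left_ideal_genE.
  by rewrite -nact_delta fA se gf trunc0 pure0r nact0r.
(* If g(x) = w in eV, then m s(ex) = m (e (x) w) = m (x) w. *)
have sS t : exists x, s x = t.
  elim/tensor_ind: t => [|t u [x <-] [y <-]|m w].
  - by exists 0; rewrite linear0.
  - by exists (x + y); rewrite linearD.
  have [x gx] := surj (im_val w); exists (nact (im_val m) (nact e x)).
  by rewrite sA se gx trunc_im_val ind_act_pure left_ideal_act_gen.
(* Write t - u = s(x); then g(x) = mu(s(x)) = 0, and s kills ker g. *)
apply: inj_surj_bijective => [t u tu|v].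
  apply/eqP; rewrite -subr_eq0; have [x sx] := sS (t - u).
  by rewrite -sx skerg // -mus sx linearB tu subrr.
by have [x <-] := surj v; exists (s x).
Qed.

(** Generators are indexed by all w in eV, with the w-th copy mapped by m |-> m (x) w; relators are
    indexed by all elements of the kernel. *)
Lemma ind_presented V : presented_by (ind_nmod V e).
Proof.
pose I : choiceType := truncation V e.
have [g gA gE] := @free_universal I (ind_nmod V e) (fun w => pure V left_ideal_gen w).
have {}gE w m : g (delta w m) = pure V m w.
  by rewrite gE ind_act_pure left_ideal_act_gen.
pose J : choiceType := {classic {k : free_nmod I | g k = 0}}.
have [f fA fE] := free_universal (fun k : J => sval k).
exists I, J, f, g; split => //; last first.
  apply/seteqP; split=> // t _; elim/tensor_ind: t => [|t u [x _ <-] [y _ <-]|m w].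
  - by exists 0; rewrite ?linear0.
  - by exists (x + y); rewrite ?linearD.
  - by exists (delta w m); rewrite ?gE.
apply/seteqP; split=> [_ [y _ <-]|x gx] /=.
  elim/free_ind: y => [|y z hy hz|k m]; first by rewrite !linear0.
    by rewrite !linearD hy hz addr0.
  by rewrite fE gA (svalP k) nact0r.
(* To show ker g inside the range of f, the projection q modulo that range is factored as h g, with
   h built from the universal property of the tensor product. *)
pose q (y : free_nmod I) : lquot (range f) := lpi _ y.
have qf k (m : left_ideal e) : g k = 0 -> q (nact (im_val m) k) = 0.
  move=> gk; rewrite /q -[RHS](linear0 (lpi (range f))); apply/lpiP.
  rewrite subr0; apply: span_pred_sub; by exists (@delta J (exist _ k gk) m).
have qE y z (m : left_ideal e) : g y = g z -> q (nact (im_val m) y) = q (nact (im_val m) z).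
  move=> yz; apply/eqP; rewrite -subr_eq0 /q -!linearB; apply/eqP/qf.
  by rewrite linearB yz subrr.
have [h hE] : exists h : {linear ind_nmod V e -> lquot (range f)},
    forall m w, h (pure V m w) = q (delta w m).
  apply: tensor_universal => [w a m m'|m a w w'|m b w].
  - by rewrite /q /delta !linearP.
  (* The copies at aw + w', w and w' are unrelated in the free module, but both sides are m times
     elements with the same image under g, so [qE] identifies them. *)
  - rewrite (@delta_gen I) (qE _ (a *: delta w left_ideal_gen + delta w' left_ideal_gen)).
      by rewrite act_linear_r -!delta_gen; exact: linearP.
    by rewrite linearP !gE pureDr pureZr.
  - rewrite [X in _ = q X](@delta_gen I).
    have bA : left_ideal_ract m b = left_ideal_act (im_val m) (left_ideal_ract left_ideal_gen b).
      by apply: val_inj; rewrite /= /rmul ee nmulA left_ideal_fix.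
    rewrite bA -nact_delta; apply: qE; rewrite !gE; exact: pure_balanced.
have hg y : h (g y) = q y.
  elim/free_ind: y => [|y z hy hz|w m]; first by rewrite /q !linear0.
    by rewrite !linearD hy hz /q -linearD.
  by rewrite gE hE.
have /lpiP : q x = q 0 by rewrite -!hg [g x]gx !linear0.
rewrite subr0 => /asboolP xf.
(* The range of f is already a submodule, so its span adds nothing. *)
have /asboolP[y <-] : x \in im_pred f.
  by apply: xf => [|_ [y _ <-]]; [exact: im_pred_closed | exact: im_pred_f].
by exists y.
Qed.

(** An unspecified isomorphism suffices to close the cycle: the induced module is always presented,
    and presentations transfer along isomorphisms. *)
Lemma mult_map_bijectiveP V :
  [<-> presented_by V; mult_map_bijective V; nmod_isomorphic (ind_nmod V e) V].
Proof.
tfae.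
- exact: mult_map_bijective_of_presented.
- exact: mult_map_isomorphic.
- by move/presented_by_isomorphic; apply; exact: ind_presented.
Qed.

End InducedModule.

(** * Enlarging the idempotent *)

(** The relations ee' = e'e = e give inclusions of Ae in Ae' and of eV in e'V, hence a map h of
    induced modules with mu' h = mu. Once h is onto, bijectivity of mu forces that of mu'. *)
Lemma mult_map_bijective_mono (R : comPzRingType) (A : nualg R) (V : nmod A) (e e' : A) :
  nmul e e = e -> nmul e' e' = e' -> nmul e e' = e -> nmul e' e = e ->
  mult_map_bijective e V -> mult_map_bijective e' V.
Proof.
move=> ee e'e' ee' e'e [mu muE mub]; have [mu' mu'E] := mult_map_exists e' V.
exists mu' => //.
pose up (m : left_ideal e) : left_ideal e' := Im (im_pred_f (rmul e') (im_val m)).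
have upE m : im_val (up m) = im_val m.
  by rewrite /= /rmul -[im_val m in LHS](left_ideal_fix ee) -nmulA ee' left_ideal_fix.
pose up_trunc (w : truncation V e) := trunc e' (im_val w).
have up_truncE w : im_val (up_trunc w) = im_val w.
  by rewrite im_val_trunc -[im_val w in LHS](truncation_fix ee) actA e'e truncation_fix.
have [h hE] : exists h : {linear ind_nmod V e -> ind_nmod V e'}, forall m w,
    h (pure _ _ m w) = pure (@left_ideal_ract R A e') (@truncation_act R A V e')
                         (up m) (up_trunc w).
  apply: tensor_universal => [w a m m'|m a w w'|m b w].
  - rewrite -pureP_l; congr pure; apply: val_inj.
    by rewrite [LHS]upE -[RHS]/(a *: im_val (up m) + im_val (up m')) !upE.
  - rewrite -pureZr -pureDr; congr pure; apply: val_inj.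
    by rewrite [LHS]up_truncE -[RHS]/(a *: im_val (up_trunc w) + im_val (up_trunc w')) !up_truncE.
  - have be' : nmul (im_val b) e' = im_val b.
      by case: b => b /= /asboolP[a <-]; rewrite /lmul /rmul /= -!nmulA ee'.
    apply: (ind_balanced e'e' (a := im_val b)); rewrite ?be'.
      by rewrite !upE.
    by rewrite [im_val (up_trunc w)]up_truncE.
have mu'h t : mu' (h t) = mu t.
  elim/tensor_ind: t => [|t u ht hu|m w]; rewrite ?linear0 ?linearD ?ht ?hu //.
  by rewrite hE mu'E upE up_truncE muE.
have hS t' : exists t, h t = t'.
  elim/tensor_ind: t' => [|t u [x <-] [y <-]|m' w'].
  - by exists 0; rewrite linear0.
  - by exists (x + y); rewrite linearD.
  (* By surjectivity of mu, w' is a sum of products mw with m in Ae and w in eV; then m' (x) e'mw =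
     m'm (x) w, which lies in the image of h. *)
  rewrite -(trunc_im_val e'e' w'); have [mui _ mu_mui] := mub.
  rewrite -(mu_mui (im_val w')).
  elim/tensor_ind: (mui _) => [|t u [x hx] [y hy]|m w].
  - by exists 0; rewrite !linear0 trunc0 pure0r.
  - by exists (x + y); rewrite !linearD hx hy truncD pureDr.
  exists (pure _ _ (left_ideal_act (im_val m') m) w); rewrite hE muE.
  apply: (ind_balanced e'e' (a := im_val m)).
    by rewrite upE -[im_val m in RHS]upE left_ideal_fix // upE.
  by rewrite im_val_trunc up_truncE.
apply: inj_surj_bijective => [t u tu|v].
  have [x hx] := hS t; have [y hy] := hS u.
  rewrite -hx -hy; congr (h _); apply: (bij_inj mub).
  by rewrite -!mu'h hx hy.
by have [mui _ mu_mui] := mub; exists (h (mui v)); rewrite mu'h.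
Qed.

(** * The idempotents of the category algebra *)

Section Idempotents.
Variables (R : pzRingType) (C : lincat R).
Implicit Types x : catalg C.

Lemma part_idem_out i m n : (m, n) != (i, i) -> part (idem C i) m n = 0.
Proof. by rewrite eq_sym; exact: dsum_inj_out. Qed.

(** Right multiplication by e_i keeps exactly the morphisms with source i. *)
Lemma part_mul_idem x i m n :
  part (nmul x (idem C i)) m n = if m == i then part x m n else 0.
Proof.
have -> : part (nmul x (idem C i)) m n =
  \sum_(k \in [set: nat]) hcomp (part x k n) (part (idem C i) m k) by [].
have [->|mi] := eqVneq m i; last first.
  by rewrite fsbig1 // => k _; rewrite part_idem_out ?compm0 // xpair_eqE (negPf mi).
rewrite (@fsumTE _ _ [:: i]) // => [|k].
  by rewrite big_seq1 [part (idem C i) i i]dsum_injE compm1.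
rewrite inE => ki; rewrite part_idem_out ?compm0 //.
by rewrite xpair_eqE (negPf ki) andbF.
Qed.

Lemma part_sum m n (s : seq nat) (F : nat -> catalg C) :
  part (\sum_(i <- s) F i) m n = \sum_(i <- s) part (F i) m n.
Proof. exact: (linear_sum (dsum_coord (m, n))). Qed.

Lemma part_mul_idems x N m n :
  part (nmul x (idems C 0 N)) m n = if (m <= N)%N then part x m n else 0.
Proof.
rewrite -[nmul x _]/(lmul x (\sum_(0 <= i < N.+1) idem C i)) linear_sum part_sum.
under eq_bigr do rewrite part_mul_idem eq_sym.
by rewrite -big_mkcond big_nat1_eq ltnS.
Qed.

Lemma part_idems N m n :
  part (idems C 0 N) m n = if (m <= N)%N then part (idem C m) m n else 0.
Proof.
rewrite part_sum (eq_bigr (fun i => if i == m then part (idem C i) m n else 0)).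
  by rewrite -big_mkcond big_nat1_eq ltnS.
move=> i _; have [//|im] := eqVneq i m.
by rewrite part_idem_out // xpair_eqE eq_sym (negPf im).
Qed.

(** One formula yields both idempotency and the relations ee' = e'e = e needed to compare two
    truncation degrees. *)
Lemma nmul_idems M N : nmul (idems C 0 M) (idems C 0 N) = idems C 0 (minn M N).
Proof.
apply: dsumP => -[m n]; rewrite -[LHS]/(part _ m n) -[RHS]/(part _ m n).
by rewrite part_mul_idems !part_idems leq_min; do 2!case: leq.
Qed.

End Idempotents.

(* Presentation degree and central stability *)
Local Close Scope ring_scope.
Local Close Scope classical_set_scope.

Theorem theorem3p2 (R : comPzRingType) (C : lincat R)
    (C_dir : forall m n : nat, n < m -> forall f : C m n, f = 0%R)
    (V : nmod (catalg C)) (V_graded : graded V) :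
  (presented_in_finite_degrees V <-> centrally_stable V) /\
  (forall V_fin : presented_in_finite_degrees V, forall N : nat,
     nmod_isomorphic (ind_nmod V (idems C 0 N)) V <-> prd V_fin <= N).
Proof.
have idem_idem N : nmul (idems C 0 N) (idems C 0 N) = idems C 0 N.
  by rewrite nmul_idems minnn.
have equivs N := mult_map_bijectiveP (idem_idem N) V.
have isoP N : nmod_isomorphic (ind_nmod V (idems C 0 N)) V <-> presented_in_degree V N.
  exact: (equivs N) 2 0.
have presented_mono M N :
    M <= N -> presented_in_degree V M -> presented_in_degree V N.
  (* Monotonicity in the degree is read off the multiplication map, not off the presentations. *)
  move=> MN /(equivs M 0 1) VM; apply/(equivs N 0 1).
  apply: mult_map_bijective_mono VM => //.
  - by rewrite nmul_idems (minn_idPl MN).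
  - by rewrite nmul_idems (minn_idPr MN).
split; first split.
- by case=> M VM; exists M => N MN; apply/isoP/(presented_mono M).
(* The stability threshold itself serves as a degree of presentation. *)
- by case=> M VM; exists M; apply/isoP/VM.
move=> V_fin N; apply: (iff_trans (isoP N)); rewrite /prd.
(* Minimality of the presentation degree gives one direction, monotonicity the other. *)
case: ex_minnP => M /asboolP VM M_min; split=> [VN|MN].
  exact/M_min/asboolP.
exact: presented_mono VM.
Qed.
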